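(* Let $K$ be a field, $x=(x_1,\dots,x_n)$ an $n$-tuple of variables, and let $R$ be a $K$-subalgebra of $K[x]$ with fraction field $L$ such that $\operatorname{trdeg}_{K} L = 1$. Then the following hold. (i) There exists a $p \in K[x]$ such that $L = K(p)$. (ii) For any $p \in K[x]$ such that $L = K(p)$, $$R \subseteq K[p] = K(p) \cap K[x],$$ and $K[p]$ is the integral closure of $R$ in its fraction field $L$.
   Context: $L$ is regarded as a subfield of $K(x)$, the fraction field of $K[x]=K[x_1,\dots,x_n]$. *)

(* Defs.v *)
From HB Require Import structures.
From mathcomp Require Import all_boot all_order all_algebra.
From mathcomp Require Import fraction mpoly.
From mathcomp Require Import boolp classical_sets.

Set Implicit Arguments.
Unset Strict Implicit.
Unset Printing Implicit Defensive.

Import GRing.Theory.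
Local Open Scope ring_scope.
Local Open Scope classical_set_scope.

Section SubringsAndSubfields.
Variable F : fieldType.
Implicit Types (A E L S : set F) (z : F).

Definition is_subfield E : Prop := divring_closed [pred z | z \in E].

Definition algebraic_over E z : Prop :=
  exists q : {poly F}, [/\ q != 0, forall i, E q`_i & root q z].

Definition integral_over A z : Prop :=
  exists q : {poly F}, [/\ q \is monic, forall i, A q`_i & root q z].

Definition integral_closure A L : set F :=
  [set z | L z /\ integral_over A z].

End SubringsAndSubfields.

Section Extensions.
Variables (K F : fieldType) (iota : {rmorphism K -> F}).
Implicit Types (L S : set F).

(* K(S): the smallest subfield of F containing the image of K and S. *)
Definition adjoin S : set F :=
  [set z | forall E : set F,
     is_subfield E -> range iota `<=` E -> S `<=` E -> E z].

Definition alg_independent d (t : 'I_d -> F) : Prop :=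
  forall q : {mpoly K[d]}, mmap iota t q = 0 -> q = 0.

Definition transcendence_basis L d (t : 'I_d -> F) : Prop :=
  [/\ forall i, L (t i), alg_independent t
    & forall z, L z -> algebraic_over (adjoin (range t)) z].

Definition has_trdeg L (d : nat) : Prop :=
  exists t : 'I_d -> F, transcendence_basis L t.

End Extensions.

(* The fraction field of a subring A of D, inside the fraction field of D. *)
Definition frac_field (D : idomainType) (A : set D) : set {fraction D} :=
  [set z | exists a b : D, [/\ A a, A b, b != 0 & z = tofrac a / tofrac b]].

Section RationalFunctions.
Variables (K : fieldType) (n : nat).

(* The embedding of K in K(x). *)
Definition ratC : {rmorphism K -> {fraction {mpoly K[n]}}} :=
  (@tofrac {mpoly K[n]} \o @mpolyC n K)%FUN.

Definition is_subalgebra (R : set {mpoly K[n]}) : Prop :=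
  subalg_closed [pred f | f \in R].

(* K[p], as a subset of K[x]. *)
Definition poly_in (p : {mpoly K[n]}) : set {mpoly K[n]} :=
  range (fun q : {poly K} => horner_alg p q).

(* K(p), as a subset of K(x). *)
Definition rat_in (p : {mpoly K[n]}) : set {fraction {mpoly K[n]}} :=
  adjoin ratC [set tofrac p].

End RationalFunctions.

(* Main.v *)
Require Import Defs.
From HB Require Import structures.
From mathcomp Require Import all_boot all_order all_algebra.
From mathcomp Require Import fraction mpoly.
From mathcomp Require Import boolp classical_sets.
From mathcomp Require Import ring zify.

Set Implicit Arguments.
Unset Strict Implicit.
Unset Printing Implicit Defensive.
Import Order.TTheory GRing.Theory.
Local Open Scope ring_scope.
Local Open Scope classical_set_scope.

(* Substituting powers of t for the variables (Kronecker) maps K[x] to K[t].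
   As L has transcendence degree one, a suitable substitution phi is injective
   on R, which reduces (i) to a subalgebra S = phi(R) of K[t].  Let M be the
   minimal polynomial of t over Frac S.  It divides f(X) - f(t) for every f in S,
   so by Gauss's lemma its coefficients lie in K[t]; let c be a nonconstant one.
   Then M divides c(X) - c(t), and comparing degrees in t shows that the quotient
   is a constant.  Hence c(X) - c(t) divides g(X) - g(t) for every g in S, and the
   c-adic expansion of g then gives g in K[c].  Now c = phi(r) / phi(s) with r, s
   in R, and c is integral over K[phi(f)] for any nonconstant phi(f), f in R; thus
   r / s is integral over K[x], so it is a polynomial p, and L = K(p).

   In (ii), the inclusion of K(p) n K[x] in K[p] is Bezout's identity in K[p],
   and the rest follows since K[x] is integrally closed and p is integral over
   K[f] for any nonconstant f in R. *)

(** * Gauss's lemma for polynomials in X over K[t] *)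

Section Gauss.
Variable K : fieldType.
Implicit Types (c d pi : {poly K}) (F P Q : {poly {poly K}}).

Lemma irreducible_divisor c : (1 < size c)%N ->
  exists2 pi, irreducible_poly pi & pi %| c.
Proof.
have [m] := ubnP (size c); elim: m c => // m IHm c; rewrite ltnS => le_cm c_gt1.
have [irr_c | red_c] := pselect (irreducible_poly c); first by exists c.
have [q /not_implyP[q_n1 /not_implyP[dv_qc nassoc]]] :
    exists q : {poly K}, ~ (size q != 1%N -> q %| c -> q %= c).
  apply: contrapT => /forallNP irr; apply: red_c; split=> // q.
  exact: contrapT (irr q).
have c_n0 : c != 0 by rewrite -size_poly_gt0 ltnW.
have q_n0 : q != 0 by apply: contraNneq c_n0 => q0; rewrite q0 dvd0p in dv_qc.
have lt_qc : (size q < size c)%N.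
  rewrite ltn_neqAle dvdp_leq // andbT (dvdp_size_eqp dv_qc); exact/negP.
have [|pi irr_pi dv_pi] := IHm q (leq_trans lt_qc le_cm).
  by rewrite ltn_neqAle eq_sym q_n1 size_poly_gt0.
by exists pi => //; apply: dvdp_trans dv_qc.
Qed.

Lemma dvdp_coefs pi P : (forall i, pi %| P`_i) -> exists P', P = pi *: P'.
Proof.
move=> dvP; exists (\poly_(i < size P) (P`_i %/ pi)); apply/polyP => i.
rewrite coefZ coef_poly; case: ltnP => [_|le_Pi]; first by rewrite mulrC divpK.
by rewrite mulr0 nth_default.
Qed.

(** If i is the least index with [pi] not dividing [Q]_i[, then modulo]pi[, by strong induction on
    j, coefficient i + j of]Q * P[is just]Q[_i * P]_j[; so]pi[divides every]P[_j]. *)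
Lemma irreducible_dvdp_mul pi F P Q : irreducible_poly pi -> pi *: F = Q * P ->
  (exists Q', Q = pi *: Q') \/ (exists P', P = pi *: P').
Proof.
move=> irr_pi eqF.
have [dvQ | ndvQ] := pselect (forall i, pi %| Q`_i).
  by left; apply: dvdp_coefs.
right; apply: dvdp_coefs => j.
have exQ : exists i, ~~ (pi %| Q`_i).
  by apply: contrapT => /forallNP h; apply: ndvQ => i; apply/negPn/negP.
case: (ex_minnP exQ) => i ndi mini.
elim/ltn_ind: j => j IHj.
have : pi %| (Q * P)`_(i + j) by rewrite -eqF coefZ dvdp_mulIl.
have lt_i : (i < (i + j).+1)%N by rewrite ltnS leq_addr.
rewrite coefM (bigD1 (Ordinal lt_i)) //= addKn dvdp_addl.
  rewrite Gauss_dvdpr //.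
  case: irr_pi => _ irr_pi; rewrite /coprimep; apply: contraNT ndi => size_n1.
  have := irr_pi _ size_n1 (dvdp_gcdl _ _).
  by rewrite /eqp => /andP[_ /dvdp_trans]; apply; apply: dvdp_gcdr.
elim/big_ind: _ => [|u v|k ne_ki]; [exact: dvdp0 | exact: dvdp_add |].
case: (ltngtP k i) => [lt_ki | lt_ik | eq_ki].
- rewrite dvdp_mulr //; apply: contraLR lt_ki => ndk.
  by rewrite -leqNgt mini.
- rewrite dvdp_mull // IHj // ltn_subLR; first by rewrite ltn_add2r.
  by have := ltn_ord k; rewrite ltnS.
- by rewrite -val_eqE /= eq_ki eqxx in ne_ki.
Qed.

(** The irreducible factors of [c] are removed one at a time: each divides [Q], where it is
    cancelled, or [P], where it is collected in [c']. A remaining constant is inverted into [Q']. *)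
Lemma gauss_split c F P Q : c != 0 -> c *: F = Q * P ->
  exists c' P' Q', [/\ c' != 0, P = c' *: P' & F = Q' * P'].
Proof.
have [m] := ubnP (size c).
elim: m c P Q => // m IHm c P Q; rewrite ltnS => le_cm c_n0 eqF.
have [/irreducible_divisor[pi irr_pi dv_pi] | c_le1] := ltnP 1 (size c).
  have pi_n0 : pi != 0 by rewrite irredp_neq0.
  have pi_gt1 : (1 < size pi)%N by case: irr_pi.
  pose d := c %/ pi; have def_c : c = d * pi by rewrite divpK.
  have d_n0 : d != 0 by apply: contraNneq c_n0 => d0; rewrite def_c d0 mul0r.
  have lt_dm : (size d < m)%N.
    apply: leq_trans le_cm; rewrite def_c size_mul // -subn1 ltn_subRL addnC ltn_add2l //.
  have eqF' : pi *: (d *: F) = Q * P by rewrite scalerA mulrC -def_c.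
  have scalI : injective (fun G : {poly {poly K}} => pi *: G).
    move=> G1 G2 /= /eqP; rewrite -subr_eq0 -scalerBr scale_poly_eq0 (negPf pi_n0).
    by rewrite subr_eq0 => /eqP.
  case: (irreducible_dvdp_mul irr_pi eqF') => -[G defG].
    apply: (IHm d P G) => //; apply: scalI; rewrite eqF' defG scalerAl //.
  have [|c' [P' [Q' [c'_n0 defP' defF]]]] := IHm d G Q lt_dm d_n0.
    by apply: scalI; rewrite eqF' defG scalerAr.
  exists (pi * c'), P', Q'; split => //; first by rewrite mulf_neq0.
  by rewrite defG defP' scalerA.
have /size_poly1P[k k_n0 def_c] : size c == 1%N.
  by rewrite eqn_leq c_le1 size_poly_gt0.
exists 1, P, (k^-1%:P *: Q); split; rewrite ?oner_eq0 ?scale1r //.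
by rewrite -scalerAl -eqF scalerA def_c -polyCM mulVf // scale1r.
Qed.
End Gauss.

(** * A Lüroth theorem for K-subalgebras of K[t] *)

Section Luroth.
Variable K : fieldType.
Implicit Types (c f g : {poly K}) (G P Q : {poly {poly K}}).

Lemma size_sub_lead (R : nzRingType) (u v : {poly R}) : u != 0 ->
  size u = size v -> lead_coef u = lead_coef v -> (size (u - v)%R < size u)%N.
Proof.
rewrite -size_poly_gt0 => u_gt0 eq_sz eq_lc.
rewrite -[X in (_ < X)%N](prednK u_gt0) ltnS; apply/leq_sizeP => j.
rewrite leq_eqVlt => /predU1P[<- | lt_j].
  by rewrite coefB {2}eq_sz -!lead_coefE eq_lc subrr.
rewrite prednK // in lt_j.
by rewrite coefB !nth_default ?subrr // -eq_sz.
Qed.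

(** The part of [d] absorbed by a monic [P] is a unit, since it divides the leading coefficient
    1. *)
Lemma monic_dvd_scale d G P Q : d != 0 -> P \is monic -> d *: G = Q * P ->
  exists Q', G = Q' * P.
Proof.
move=> d_n0 mon_P /(gauss_split d_n0)[c [P' [Q' [c_n0 defP defG]]]].
have lcP : c * lead_coef P' = 1 by rewrite -lead_coefZ -defP (monicP mon_P).
exists (lead_coef P' *: Q').
by rewrite defP -scalerAl -scalerAr scalerA mulrC lcP scale1r.
Qed.

(* f(X) - f(t), as a polynomial in X with coefficients in K[t]. *)
Definition diffXY f : {poly {poly K}} := f^:P - f%:P.

Lemma diffXY_root f : (diffXY f).['X] = 0.
Proof.
by rewrite /diffXY hornerD hornerN hornerC -/(comp_poly 'X f) comp_polyXr subrr.
Qed.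

Lemma size_diffXY f : (1 < size f)%N -> size (diffXY f) = size f.
Proof.
move=> f_gt1; rewrite /diffXY size_polyDl size_map_polyC // size_polyN.
by apply: leq_ltn_trans f_gt1; rewrite size_polyC leq_b1.
Qed.

Lemma lead_coef_diffXY f : (1 < size f)%N ->
  lead_coef (diffXY f) = (lead_coef f)%:P.
Proof.
move=> f_gt1; rewrite /diffXY lead_coefDl ?lead_coef_map_inj //; first exact: polyC_inj.
rewrite size_map_polyC // size_polyN.
by apply: leq_ltn_trans f_gt1; rewrite size_polyC leq_b1.
Qed.

Lemma swapXY_diffXY f : swapXY (diffXY f) = - diffXY f.
Proof. by rewrite /diffXY raddfB /= swapXY_map_polyC swapXY_polyC opprB. Qed.

(* Comparing degrees in t: only a constant factor is left over. *)
Lemma diffXY_factor c P Q i : (1 < size c)%N -> (size c <= size (P`_i)%R)%N ->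
  diffXY c = Q * P -> exists2 k : K, k != 0 & diffXY c = k%:P *: P.
Proof.
move=> c_gt1 le_cP defC.
have C_n0 : diffXY c != 0 by rewrite -size_poly_gt0 size_diffXY // ltnW.
have [Q_n0 P_n0] : Q != 0 /\ P != 0.
  by apply/andP; rewrite -negb_or -mulf_eq0 -defC.
have := congr1 (@swapXY K) defC; rewrite swapXY_diffXY rmorphM /=.
set Q' := swapXY Q; set P' := swapXY P => defC'.
have Q'_n0 : Q' != 0 by rewrite swapXY_eq0.
have P'_n0 : P' != 0 by rewrite swapXY_eq0.
have le_cP' : (size c <= size P')%N.
  by rewrite -sizeYE; apply: leq_trans (max_size_coefXY _ i).
(* After the swap [P'] already has the full degree of [diffXY c] in X, so nothing is left for
   [Q']. *)
have /size_poly1P[q q_n0 defQ'] : size Q' == 1%N.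
  have := congr1 (fun u : {poly {poly K}} => size u) defC'.
  rewrite /= size_polyN size_diffXY // size_mul // => eq_c.
  have : (0 < size Q')%N by rewrite size_poly_gt0.
  move: le_cP'; move: (size c) (size Q') (size P') eq_c; lia.
(* [q] divides the leading coefficient of [- diffXY c], which is a constant. *)
have /size_poly1P[k k_n0 defq] : size q == 1%N.
  have := congr1 (@lead_coef _) defC'.
  rewrite lead_coefN lead_coef_diffXY // defQ' lead_coefM lead_coefC => eq_lc.
  have /(congr1 (fun u : {poly K} => size u)) := eq_lc.
  have lc_n0 : lead_coef P' != 0 by rewrite lead_coef_eq0.
  rewrite /= size_polyN size_polyC lead_coef_eq0.
  have -> : c != 0 by rewrite -size_poly_gt0 ltnW.
  rewrite size_mul // => eq_1; move: q_n0 lc_n0 eq_1; rewrite -!size_poly_gt0.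
  by move: (size q) (size (lead_coef P')); lia.
exists k => //; rewrite defC -mul_polyC; congr (_ * _).
by rewrite -[Q]swapXYK -/Q' defQ' defq swapXY_polyC map_polyC.
Qed.

(** Modulo c(X) - c(t), each c(X) in the c-adic expansion of g(X) may be replaced by c(t). What
    remains has degree below that of [c] in X, and its coefficients are polynomials in c(t). *)
Lemma cadic_remainder c g : (1 < size c)%N ->
  exists r T : {poly {poly K}}, [/\ (size r < size c)%N,
     forall i : nat, exists h : {poly K}, r`_i = h \Po c & g^:P - r = T * diffXY c].
Proof.
move=> c_gt1; have c_n0 : c != 0 by rewrite -size_poly_gt0 ltnW.
have [m] := ubnP (size g); elim: m g => // m IHm g; rewrite ltnS => le_gm.
have [lt_gc | le_cg] := ltnP (size g) (size c).
  exists g^:P, 0; split; rewrite ?size_map_polyC ?subrr ?mul0r // => i.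
  by exists (g`_i)%:P; rewrite coef_map comp_polyC.
have [|r [T [lt_rc r_c defT]]] := IHm (g %/ c).
  apply: leq_trans le_gm; rewrite size_divp // -subn1 ltn_subrL.
  by rewrite subn_gt0 c_gt1 (leq_trans _ le_cg) // ltnW.
exists (c *: r + (g %% c)^:P), ((g %/ c)^:P + c *: T); split.
- apply: leq_ltn_trans (size_polyD _ _) _; rewrite gtn_max size_map_polyC.
  rewrite ltn_modp c_n0 andbT; apply: leq_ltn_trans lt_rc.
  by rewrite size_scale.
- move=> i; have [h defh] := r_c i; exists ('X * h + ((g %% c)`_i)%:P).
  by rewrite coefD coefZ coef_map comp_polyD comp_polyM comp_polyX comp_polyC defh.
- rewrite {1}(divp_eq g c) rmorphD rmorphM /=.
  have -> : r = (g %/ c)^:P - T * diffXY c by rewrite -defT opprB addrC subrK.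
  rewrite -!mul_polyC /diffXY; ring.
Qed.

(** Both g(t) and the c-adic remainder are congruent to g(X) modulo c(X) - c(t) and have smaller
    degree in X than [c], so they coincide; coefficient 0 of the remainder is a polynomial in
    [c]. *)
Lemma comp_poly_of_dvd c g Q : (1 < size c)%N -> diffXY g = Q * diffXY c ->
  exists h, g = h \Po c.
Proof.
move=> c_gt1 defQ; have [r [T [lt_rc r_c defT]]] := cadic_remainder g c_gt1.
have eq_r : r - g%:P = (Q - T) * diffXY c.
  by rewrite mulrBl -defQ -defT /diffXY; ring.
have /eqP : Q - T == 0.
  apply: contraTT isT => QT_n0.
  have : (size (r - g%:P)%R < size c)%N.
    apply: leq_ltn_trans (size_polyD _ _) _; rewrite gtn_max lt_rc size_polyN.
    by apply: leq_ltn_trans c_gt1; rewrite size_polyC leq_b1.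
  have C_n0 : diffXY c != 0 by rewrite -size_poly_gt0 size_diffXY // ltnW.
  rewrite eq_r size_mul // size_diffXY // -subn1 ltn_subLR.
    by rewrite ltn_add2r ltnS leqn0 size_poly_eq0 (negPf QT_n0).
  by rewrite addn_gt0 (ltnW c_gt1) orbT.
move=> QT0; have /eqP := eq_r; rewrite QT0 mul0r subr_eq0 => /eqP defr.
by have [h] := r_c 0%N; rewrite defr coefC eqxx => ->; exists h.
Qed.

Variable S : {poly K} -> Prop.
Hypothesis SC : forall a, S a%:P.
Hypothesis SD : forall u v, S u -> S v -> S (u + v).
Hypothesis SM : forall u v, S u -> S v -> S (u * v).

Let SN u : S u -> S (- u).
Proof. by move=> Su; rewrite -mulN1r -polyCN; apply: SM. Qed.

Let SB u v : S u -> S v -> S (u - v).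
Proof. by move=> Su Sv; apply: SD => //; apply: SN. Qed.

(** A nonzero relation of least degree is the minimal polynomial of t over Frac S, up to a factor
    clearing denominators. *)
Definition relation_at_t G := (forall i, S G`_i) /\ G.['X] = 0.

(** Pseudo-division by [P]: cross-multiplying by leading coefficients keeps the coefficients in [S],
    and minimality leaves no nonzero remainder. [b] accumulates the powers of [lead_coef P]. *)
Lemma minimal_relation_dvd P G :
    relation_at_t P -> P != 0 ->
    (forall G, relation_at_t G -> G != 0 -> (size P <= size G)%N) ->
    relation_at_t G ->
  exists (b : {poly K}) (Q : {poly {poly K}}), b != 0 /\ b *: G = Q * P.
Proof.
move=> [SP P0] P_n0 minP.
have [m] := ubnP (size G); elim: m G => // m IHm G; rewrite ltnS => le_Gm relG.
have [-> | G_n0] := eqVneq G 0.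
  by exists 1, 0; rewrite oner_neq0 scaler0 mul0r.
have le_PG := minP G relG G_n0; have [SG G0] := relG.
pose M := lead_coef G *: 'X^(size G - size P).
pose G' := lead_coef P *: G - M * P.
have lcP_n0 : lead_coef P != 0 by rewrite lead_coef_eq0.
have sz_M : size (M * P) = size G.
  rewrite /M -scalerAl size_scale ?lead_coef_eq0 // mulrC size_mulXn //.
  by rewrite subnK.
have lt_G'G : (size G' < size G)%N.
  rewrite -[X in (_ < X)%N](@size_scale _ (lead_coef P)) //.
  apply: size_sub_lead; rewrite ?scale_poly_eq0 ?negb_or ?lcP_n0 //.
    by rewrite size_scale.
  by rewrite lead_coefM !lead_coefZ lead_coefXn mulr1 mulrC.
have relG' : relation_at_t G'.
  split=> [i|]; last first.
    by rewrite hornerD hornerN hornerM P0 hornerZ G0 !mulr0 subr0.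
  rewrite coefB coefZ -scalerAl coefZ coefXnM; apply: SB.
    by apply: SM; rewrite ?lead_coefE.
  by case: ifP => _; [rewrite mulr0 -polyC0 | apply: SM; rewrite ?lead_coefE].
have [b [Q [b_n0 defQ]]] := IHm G' (leq_trans lt_G'G le_Gm) relG'.
exists (b * lead_coef P), (Q + b *: M); split; first by rewrite mulf_neq0.
by rewrite mulrDl -defQ -scalerA -scalerAl -scalerDr subrK.
Qed.

Lemma relation_diffXY b c : S b -> S (b * c) -> relation_at_t (b *: diffXY c).
Proof.
move=> Sb Sbc; split=> [i|]; last by rewrite hornerZ diffXY_root mulr0.
rewrite coefZ coefB coef_map coefC mulrBr; apply: SB; first by apply: SM => //; apply: SC.
by case: ifP => _ //; rewrite mulr0 -polyC0; apply: SC.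
Qed.

(** The generator [c] need not lie in [S], only in Frac S; it is recorded as the fraction [b * c]
    over [b]. *)
Lemma luroth_univariate f : S f -> (1 < size f)%N ->
  exists b c, [/\ S b, S (b * c), b != 0
    & forall g, S g -> exists h, g = h \Po c].
Proof.
move=> Sf f_gt1.
have rel1 c : S c -> relation_at_t (diffXY c).
  by move=> Sc; rewrite -[diffXY c]scale1r; apply: relation_diffXY;
    [rewrite -polyC1 | rewrite mul1r].
have F_n0 : diffXY f != 0 by rewrite -size_poly_gt0 size_diffXY // ltnW.
pose isrel m := `[< exists P, [/\ relation_at_t P, P != 0 & size P = m] >].
have ex_rel : exists m, isrel m.
  by exists (size (diffXY f)); apply/asboolP; exists (diffXY f); split => //; apply: rel1.
case: (ex_minnP ex_rel) => m /asboolP[P [relP P_n0 <-]] minP0.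
have {minP0} minP G : relation_at_t G -> G != 0 -> (size P <= size G)%N.
  by move=> relG G_n0; apply: minP0; apply/asboolP; exists G.
have dvP G : relation_at_t G -> exists b Q, b != 0 /\ b *: G = Q * P.
  exact: minimal_relation_dvd.
have [b [Q [b_n0 defQ]]] := dvP _ (rel1 f Sf).
(* The factor [P'] of [diffXY f] inherits a constant leading coefficient, so it rescales to the
   monic minimal polynomial [M], with coefficients in K[t]. *)
have [c' [P' [Q' [c'_n0 defP defF]]]] := gauss_split b_n0 defQ.
have := lead_coef_diffXY f_gt1; rewrite defF lead_coefM => lcF.
have lcf_n0 : lead_coef f != 0.
  by rewrite lead_coef_eq0 -size_poly_gt0 ltnW.
have /size_poly1P[k k_n0 lcP'] : size (lead_coef P') == 1%N.
  have : lead_coef P' %| (lead_coef f)%:P by rewrite -lcF dvdp_mulIr.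
  rewrite -[X in _ %| X]mulr1 mul_polyC dvdpZr // dvdp1 => //.
pose M := k^-1%:P *: P'.
have mon_M : M \is monic.
  by rewrite monicE lead_coefZ lcP' -polyCM mulVf.
pose B := c' * k%:P.
have B_n0 : B != 0 by rewrite mulf_neq0 // polyC_eq0.
have defPM : P = B *: M by rewrite /B /M scalerA -mulrA -polyCM mulfV // mulr1.
have SB' : S B.
  have := relP.1 (size P).-1.
  by rewrite -lead_coefE defPM lead_coefZ (monicP mon_M) mulr1.
have SBM i : S (B * M`_i) by rewrite -coefZ -defPM; apply: relP.1.
have M0 : M.['X] = 0.
  have := relP.2; rewrite defPM hornerZ => /eqP; rewrite mulf_eq0 (negPf B_n0).
  by move/eqP.
(* Were all coefficients of [M] constants, [M] would be a nonzero polynomial over K vanishing at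
   t. *)
have [i Mi_gt1] : exists i, (1 < size (M`_i)%R)%N.
  apply: contrapT => /forallNP cstM.
  pose M0' := \poly_(i < size M) (M`_i)`_0.
  have defM : M = M0'^:P.
    apply/polyP => i; rewrite coef_map coef_poly /=.
    have /negP := cstM i; rewrite -leqNgt => /size1_polyC defMi.
    case: ltnP => [_|le_Mi]; first by rewrite {1}defMi.
    by rewrite nth_default.
  move: M0 mon_M; rewrite defM -/(comp_poly 'X M0') comp_polyXr => ->.
  by rewrite map_poly0 monicE lead_coef0 eq_sym oner_eq0.
pose c := M`_i.
(* [M] divides e(X) - e(t) for every polynomial [e] in Frac S; the denominators [d] and [a] drop out
   because [M] is monic. *)
have dvM e a : S a -> a != 0 -> S (a * e) -> exists Q, diffXY e = Q * M.
  move=> Sa a_n0 Sae; have [d [U [d_n0 defU]]] := dvP _ (relation_diffXY Sa Sae).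
  apply: (@monic_dvd_scale (d * a) _ _ (U * B%:P)) => //.
    by rewrite mulf_neq0.
  by rewrite -scalerA defU defPM -mulrA mul_polyC.
have [U defU] := dvM c B SB' B_n0 (SBM i).
(* As [c] is itself a coefficient of [M], the required bound on the degree in t is trivial. *)
have [q q_n0 defc] := diffXY_factor Mi_gt1 (leqnn _) defU.
exists B, c; split => // [|g Sg]; first exact: SBM.
have [V defV] : exists V, diffXY g = V * M.
  by apply: (dvM g 1); rewrite ?oner_eq0 ?mul1r // -polyC1.
apply: (@comp_poly_of_dvd _ _ ((q^-1)%:P%:P * V)) => //.
rewrite defV defc -mul_polyC [RHS](_ : _ = (q^-1 * q)%:P%:P * (V * M)).
  by rewrite mulVf // mul1r.
by rewrite !polyCM; ring.
Qed.
End Luroth.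

(** * Evaluation at fractions with denominators cleared *)

Section Homogenization.
Implicit Types (A B : comNzRingType).

(* b ^ d * q(a / b), with the denominators cleared. *)
Definition hom_eval A (d : nat) (q : {poly A}) (a b : A) : A :=
  \sum_(j < d.+1) q`_j * a ^+ j * b ^+ (d - j).

Lemma rmorph_hom_eval A B (h : {rmorphism A -> B}) d q a b :
  h (hom_eval d q a b) = hom_eval d (map_poly h q) (h a) (h b).
Proof.
rewrite /hom_eval rmorph_sum; apply: eq_bigr => j _.
by rewrite !rmorphM !rmorphXn coef_map.
Qed.

Lemma hom_eval_mul A d (q : {poly A}) (b z : A) : (size q <= d.+1)%N ->
  hom_eval d q (b * z) b = b ^+ d * q.[z].
Proof.
move=> le_qd; rewrite (horner_coef_wide _ le_qd) mulr_sumr; apply: eq_bigr => j _.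
have -> : b ^+ d = b ^+ (d - j) * b ^+ j by rewrite -exprD subnK // -ltnS.
by rewrite exprMn; ring.
Qed.

Lemma hom_eval_scale (A : comNzRingType) d (q : {poly A}) a b g :
  hom_eval d q (a * g) (b * g) = hom_eval d q a b * g ^+ d.
Proof.
rewrite /hom_eval mulr_suml; apply: eq_bigr => j _.
have -> : g ^+ d = g ^+ (d - j) * g ^+ j by rewrite -exprD subnK // -ltnS.
by rewrite !exprMn; ring.
Qed.

Lemma hom_eval_widen (A : comNzRingType) d e (q : {poly A}) a b :
  (size q <= d.+1)%N -> hom_eval (d + e) q a b = hom_eval d q a b * b ^+ e.
Proof.
move=> le_qd; elim: e => [|e IHe]; first by rewrite addn0 mulr1.
rewrite addnS exprSr mulrA -IHe /hom_eval big_ord_recr /=.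
rewrite nth_default ?mul0r ?addr0; last by rewrite (leq_trans le_qd) // ltnS leq_addr.
rewrite mulr_suml; apply: eq_bigr => j _.
have le_jd : (j <= d + e)%N by rewrite -ltnS.
by rewrite subSn // exprSr mulrA.
Qed.

(** The relation makes r / s integral of degree m, so s^m should be a common denominator of all its
    powers. Strong induction on k, rewriting r^m by the relation, shows this without dividing. *)
Lemma hom_eval_monic_pow_dvd A (q : {poly A}) (r s : A) : q \is monic ->
    hom_eval (size q).-1 q r s = 0 ->
  forall k, exists d, s ^+ (size q).-1 * r ^+ k = d * s ^+ k.
Proof.
move=> mon_q; set m := (size q).-1 => q0.
have r_m : r ^+ m = - (\sum_(i < m) q`_i * r ^+ i * s ^+ (m - i)).
  move: q0; rewrite /hom_eval big_ord_recr /= subnn mulr1 -lead_coefE.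
  rewrite (monicP mon_q) mul1r.
  by move/eqP; rewrite addrC addr_eq0 => /eqP.
elim/ltn_ind => k IHk; have [le_km | /ltnW le_mk] := leqP k m.
  exists (s ^+ (m - k) * r ^+ k).
  by rewrite -[in LHS](subnK le_km) exprD mulrAC.
have IHsum (i : 'I_m) : exists d, s ^+ m * r ^+ (i + (k - m)) = d * s ^+ (i + (k - m)).
  by apply: IHk; rewrite -{2}(subnKC le_mk) ltn_add2r.
have [d defd] := choice IHsum.
exists (- \sum_(i < m) q`_i * d i).
rewrite -[in LHS](subnKC le_mk) exprD r_m mulNr mulrN mulNr mulrA mulr_sumr !mulr_suml.
congr (- _); apply: eq_bigr => i _.
have -> : s ^+ k = s ^+ (i + (k - m)) * s ^+ (m - i).
  by rewrite -exprD; congr (_ ^+ _); have := ltn_ord i; lia.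
transitivity (q`_i * s ^+ (m - i) * (s ^+ m * r ^+ (i + (k - m)))).
  by rewrite exprD; ring.
by rewrite defd; ring.
Qed.
End Homogenization.

(** * K[x] is integrally closed *)

Section MpolyIntegrallyClosed.
Variables (K : fieldType) (n : nat).
Implicit Types (e r s p : {mpoly K[n]}).

(* K[x] is completely integrally closed: division of r by s with respect to
   leading monomials never gets stuck. *)
Lemma mpoly_dvd_of_pow_dvd e r s : e != 0 -> s != 0 ->
  (forall k, exists d : {mpoly K[n]}, e * r ^+ k = d * s ^+ k) -> exists p, r = p * s.
Proof.
move=> e_n0 s_n0; elim/mleadrect: r => r IHr dv_r.
have [-> | r_n0] := eqVneq r 0; first by exists 0; rewrite mul0r.
have le_sr : (mlead s <= mlead r)%MM.
  apply/mnm_lepP => i; rewrite leqNgt; apply/negP => lt_rs.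
  (* If x_i has a larger exponent in [mlead s] than in [mlead r], the k-th powers differ there by at
     least k, and this k exceeds what [e] can make up. *)
  have [d defd] := dv_r (mlead e i).+1.
  have d_n0 : d != 0.
    apply: contraTneq (mulf_neq0 e_n0 (expf_neq0 (mlead e i).+1 r_n0)) => d0.
    by rewrite defd d0 mul0r negbK.
  have := congr1 (fun p => mlead p i) defd.
  rewrite (mleadM e_n0 (expf_neq0 _ r_n0)) (mleadM d_n0 (expf_neq0 _ s_n0)).
  rewrite (mleadX _ r_n0) (mleadX _ s_n0) !mnmDE !mulmnE.
  move: lt_rs; move: (mlead e i) (mlead r i) (mlead s i) (mlead d i) => E a b D lt_ab.
  by have := leq_mul lt_ab (leqnn E.+1); rewrite mulSn; lia.
have [m lead_r] : exists m, mlead r = (m + mlead s)%MM.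
  by exists (mlead r - mlead s)%MM; rewrite submK.
have lcr_n0 : mleadc r != 0 by rewrite mleadc_eq0.
have lcs_n0 : mleadc s != 0 by rewrite mleadc_eq0.
have c_n0 : mleadc r / mleadc s != 0 by rewrite mulf_neq0 ?invr_eq0.
pose u : {mpoly K[n]} := (mleadc r / mleadc s) *: 'X_[m].
have X_n0 : 'X_[m] != 0 :> {mpoly K[n]} by rewrite -msupp_eq0 msuppX.
have lead_us : mlead (u * s) = mlead r.
  by rewrite /u -scalerAl mleadZ ?(mleadM X_n0 s_n0) ?mleadXm.
have leadc_us : (u * s)@_(mlead r) = mleadc r.
  have := mleadcM 'X_[m] s; rewrite mleadXm mcoeffX eqxx mul1r -lead_r => Xs.
  by rewrite /u -scalerAl mcoeffZ Xs mulrVK ?unitfE.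
(* The hypothesis survives a division step: in the binomial expansion, [e * r ^+ (k - i)] supplies
   s^(k - i) and [(u * s) ^+ i] the rest. *)
have dv_r' k : exists d : {mpoly K[n]}, e * (r - u * s) ^+ k = d * s ^+ k.
  rewrite -mulNr exprDn mulr_sumr.
  elim/big_ind: _ => [|_ _ [d1 ->] [d2 ->]|i _]; first by exists 0; rewrite mul0r.
    by exists (d1 + d2); rewrite mulrDl.
  have [d defd] := dv_r (k - i)%N.
  exists ((d * (- u) ^+ i) *+ 'C(k, i)).
  have -> : s ^+ k = s ^+ (k - i) * s ^+ i by rewrite -exprD subnK // -ltnS.
  rewrite mulrnAr mulrnAl exprMn; congr (_ *+ _).
  transitivity ((e * r ^+ (k - i)) * ((- u) ^+ i * s ^+ i)); first by ring.
  by rewrite defd; ring.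
have [r'0 | r'_n0] := eqVneq (r - u * s) 0.
  by exists u; apply/eqP; rewrite -subr_eq0 r'0.
have [|p defp] := IHr (r - u * s) _ dv_r'.
  rewrite lt_neqAle; apply/andP; split; last first.
    by apply: le_trans (mleadB_le _ _) _; rewrite lead_us joinxx.
  apply: contraNneq r'_n0 => eq_lead.
  by rewrite -mleadc_eq0 eq_lead mcoeffB leadc_us subrr.
by exists (p + u); rewrite mulrDl -defp subrK.
Qed.

Lemma mpoly_integrally_closed (q : {poly {mpoly K[n]}}) r s : s != 0 ->
  q \is monic -> hom_eval (size q).-1 q r s = 0 -> exists p, r = p * s.
Proof.
move=> s_n0 mon_q q0; apply: (@mpoly_dvd_of_pow_dvd (s ^+ (size q).-1)) => //.
  exact: expf_neq0.
exact: hom_eval_monic_pow_dvd.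
Qed.
End MpolyIntegrallyClosed.

(** * The simple extension K(tau) *)

Section SimpleExtension.
Variables (K F : fieldType) (iota : {rmorphism K -> F}) (tau : F).

Definition ev : {rmorphism {poly K} -> F} := (horner_eval tau \o map_poly iota)%FUN.

Lemma subfieldP (E : set F) : is_subfield E ->
  [/\ E 1, forall x y, E x -> E y -> E (x + y), forall x y, E x -> E y -> E (x * y)
    & forall x y, E x -> E y -> E (x / y)].
Proof.
case=> /= E1 EB' Ediv'; rewrite !inE in E1.
have EB x y : E x -> E y -> E (x - y).
  by move=> Ex Ey; have := EB' x y; rewrite !inE; apply.
have Ediv x y : E x -> E y -> E (x / y).
  by move=> Ex Ey; have := Ediv' x y; rewrite !inE; apply.
have EN x : E x -> E (- x).
  by move=> Ex; rewrite -sub0r -(subrr 1); apply: (EB) => //; apply: (EB).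
split=> // x y Ex Ey; first by rewrite -[y]opprK; apply: (EB) => //; apply: (EN).
by rewrite -[y]invrK; apply: (Ediv) => //; rewrite -div1r; apply: (Ediv).
Qed.

Lemma subfield_ev (E : set F) u : is_subfield E -> range iota `<=` E -> E tau ->
  E (ev u).
Proof.
move=> /subfieldP[_ ED EM _] Eiota Etau.
have EC c : E (iota c) by apply: Eiota; exists c.
elim/poly_ind: u => [|u c IHu]; first by rewrite rmorph0 -(rmorph0 iota).
rewrite rmorphD rmorphM /= /horner_eval /= map_polyX map_polyC hornerX hornerC.
by apply: ED; [apply: EM | apply: EC].
Qed.

Lemma adjoin1P z : adjoin iota [set tau] z <->
  exists u v, ev v != 0 /\ z = ev u / ev v.
Proof.
split=> [|[u [v [_ ->]]] E Efield Eiota Etau]; last first.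
  have Et : E tau by apply: Etau.
  by have [_ _ _] := subfieldP Efield; apply; apply: subfield_ev.
pose E : set F := [set z | exists u v, ev v != 0 /\ z = ev u / ev v].
have n10 : ev 1 != 0 by rewrite rmorph1 oner_eq0.
move/(_ E); apply.
- split=> /= [|x y|x y]; rewrite !inE.
  + by exists 1, 1; rewrite divff.
  + move=> [u [v [v_n0 ->]]] [u' [v' [v'_n0 ->]]]; exists (u * v' - u' * v), (v * v').
    rewrite !rmorphB !rmorphM mulf_neq0 //; split=> //; field.
    by rewrite v_n0 v'_n0.
  + move=> [u [v [v_n0 ->]]] [u' [v' [v'_n0 ->]]].
    (* A quotient by zero is 0 by convention, so closure must cover this case too. *)
    have [u'0 | u'_n0] := eqVneq (ev u') 0.
      by exists 0, 1; rewrite u'0 rmorph0 !mul0r invr0 mulr0.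
    exists (u * v'), (v * u'); rewrite !rmorphM mulf_neq0 //; split=> //; field.
    by rewrite v_n0 u'_n0.
- move=> _ [c _ <-]; exists c%:P, 1; split=> //.
  by rewrite rmorph1 divr1 /= /horner_eval map_polyC hornerC.
- move=> _ ->; exists 'X, 1; split=> //.
  by rewrite rmorph1 divr1 /= /horner_eval map_polyX hornerX.
Qed.

Lemma clear_denominators (q : {poly F}) :
    (forall i, adjoin iota [set tau] q`_i) ->
  exists v (W : {poly {poly K}}), ev v != 0 /\ ev v *: q = map_poly ev W.
Proof.
elim/poly_ind: q => [|q c IHq] Eq.
  by exists 1, 0; rewrite rmorph1 oner_eq0 scaler0 rmorph0.
have [|v [W [v_n0 defW]]] := IHq.
  by move=> i; have := Eq i.+1; rewrite coefD coefMX coefC addr0.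
have := Eq 0%N; rewrite coefD coefMX coefC add0r => /adjoin1P[u [w [w_n0 ->]]].
exists (v * w), (w%:P * W * 'X + (v * u)%:P); rewrite rmorphM mulf_neq0 //; split=> //.
have -> : map_poly ev (w%:P * W * 'X + (v * u)%:P)
    = (ev w)%:P * (ev v *: q) * 'X + (ev v * ev u)%:P.
  by rewrite rmorphD !rmorphM /= -defW map_polyX !map_polyC.
have <- : ev v * ev w * (ev u / ev w) = ev v * ev u by field.
by rewrite -!mul_polyC !polyCM; ring.
Qed.

End SimpleExtension.

(** * Polynomials and fractions in p *)

Section PolynomialsInP.
Variables (K : fieldType) (n : nat) (p : {mpoly K[n]}).
Implicit Types u v : {poly K}.
Local Notation H := (horner_alg p).

Lemma ev_tofrac u : ev (ratC K n) (tofrac p) u = tofrac (horner_alg p u).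
Proof.
rewrite /horner_alg /horner_morph /= -horner_map /= /horner_eval -map_poly_comp.
congr (_.[_]); apply: eq_map_poly => c /=.
by rewrite -mul_mpolyC mulr1.
Qed.

(** Once the gcd is cancelled, Bezout's identity a u' + b v' = 1 evaluated at [p], with u'(p) =
    v'(p) w, shows that v'(p) is a unit of K[x], hence a constant. *)
Lemma poly_in_of_quotient u v (w : {mpoly K[n]}) : horner_alg p v != 0 ->
  horner_alg p u = horner_alg p v * w -> poly_in p w.
Proof.
move=> v_n0 def_u.
pose g := gcdp u v; pose u' := u %/ g; pose v' := v %/ g.
have defu : u = u' * g by rewrite divpK // dvdp_gcdl.
have defv : v = v' * g by rewrite divpK // dvdp_gcdr.
have Hg_n0 : H g != 0.
  by apply: contraNneq v_n0 => g0; rewrite defv rmorphM /= g0 mulr0.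
have Hv'_n0 : H v' != 0.
  by apply: contraNneq v_n0 => v0; rewrite defv rmorphM /= v0 mul0r.
have def_u' : H u' = H v' * w.
  have Hu : H u = H u' * H g by rewrite {1}defu rmorphM.
  have Hv : H v = H v' * H g by rewrite {1}defv rmorphM.
  by apply: (mulIf Hg_n0); rewrite -Hu def_u Hv mulrAC.
have /Bezout_eq1_coprimepP[[a b] /= ab1] : coprimep u' v'.
  apply: coprimep_div_gcd; rewrite orbC; apply/orP; left.
  by apply: contraNneq v_n0 => ->; rewrite rmorph0.
have /mpoly_intro_unit /andP[/eqP Hv'_C Hv'_unit] : (H a * w + H b) * H v' = 1.
  rewrite -(rmorph1 H) -ab1 rmorphD !rmorphM /= def_u'; ring.
exists (((H v')@_0)^-1 *: u') => //; move: (_@_0) Hv'_C Hv'_unit => c Hv'_C c_unit.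
by rewrite linearZ /= def_u' Hv'_C mul_mpolyC -scalerAl mul1r scalerA mulVr // scale1r.
Qed.

End PolynomialsInP.

(** * The Kronecker substitution *)

Section KroneckerSubstitution.
Variables (K : fieldType) (n : nat).
Implicit Types a b : {mpoly K[n]}.

Lemma digits_inj N d (f g : 'I_d -> nat) :
    (forall i, f i < N)%N -> (forall i, g i < N)%N ->
  (\sum_i f i * N ^ i = \sum_i g i * N ^ i)%N -> f =1 g.
Proof.
elim: d f g => [|d IHd] f g lt_fN lt_gN; first by move=> _ [].
rewrite !big_ord_recl !expn0 !muln1.
have shift (h : 'I_d.+1 -> nat) : (\sum_(i < d) h (lift ord0 i) * N ^ lift ord0 i
    = (\sum_(i < d) h (lift ord0 i) * N ^ i) * N)%N.
  by rewrite big_distrl; apply: eq_bigr => i _; rewrite lift0 expnSr mulnA.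
rewrite !shift => eq_fg.
have N_gt0 : (0 < N)%N by apply: leq_ltn_trans (lt_fN ord0).
have eq0 : f ord0 = g ord0.
  by have := congr1 (modn^~ N) eq_fg; rewrite ![(_ + _ * N)%N]addnC !modnMDl !modn_small.
move: eq_fg; rewrite eq0 => /addnI /eqP; rewrite eqn_pmul2r // => /eqP eqS i.
case: (unliftP ord0 i) => [j ->|-> //].
exact: (IHd (fun j => f (lift ord0 j)) (fun j => g (lift ord0 j))).
Qed.

Definition kronecker (N : nat) : {rmorphism {mpoly K[n]} -> {poly K}} :=
  mmap polyC (fun i : 'I_n => 'X^(N ^ i)).

(** With exponents below [N], distinct monomials go to distinct powers of t by uniqueness of base-N
    digits, so the leading coefficient of [a] survives as a coefficient of the image. *)
Lemma kronecker_eq0 N a : (forall m i, m \in msupp a -> (m i < N)%N) ->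
  kronecker N a = 0 -> a = 0.
Proof.
move=> lt_N a0; apply/eqP; apply: contraT => a_n0.
have supp_a := mlead_supp a_n0.
pose w (m : 'X_{1..n}) := (\sum_(i < n) m i * N ^ i)%N.
have := congr1 (fun q : {poly K} => q`_(w (mlead a))) a0.
rewrite /= /mmap coef0 coef_sum (bigD1_seq _ supp_a) ?msupp_uniq //=.
have mmapw m : mmap1 (fun i : 'I_n => 'X^(N ^ i) : {poly K}) m = 'X^(w m).
  rewrite /mmap1 -prodrXr; apply: eq_bigr => i _.
  by rewrite -exprM mulnC.
rewrite big_seq_cond big1 ?addr0 => [|m /andP[supp_m ne_m]].
  by rewrite mmapw coefCM coefXn eqxx mulr1 => /eqP; rewrite mleadc_eq0 (negPf a_n0).
rewrite mmapw coefCM coefXn.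
case: eqP => [eq_w|]; last by rewrite mulr0.
case/eqP: ne_m; apply/mnmP => i; symmetry.
by apply: (digits_inj _ _ eq_w) => j; apply: lt_N.
Qed.

(** A single [N] bounding the degrees of [a] and [b] serves all their combinations. *)
Lemma kronecker_lin_indep a b :
  exists N, forall c d, kronecker N (c *: a + d *: b) = 0 -> c *: a + d *: b = 0.
Proof.
exists (maxn (msize a) (msize b)) => c d /kronecker_eq0; apply => m i.
move=> /msize_mdeg_lt lt_m.
have le_sz : (msize (c *: a + d *: b) <= maxn (msize a) (msize b))%N.
  apply: leq_trans (msizeD_le _ _) _; rewrite geq_max.
  by rewrite !(leq_trans (msizeZ_le _ _)) ?leq_maxl ?leq_maxr.
apply: leq_trans le_sz; apply: leq_ltn_trans lt_m.
by rewrite mdegE (bigD1 i) //= leq_addr.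
Qed.

End KroneckerSubstitution.

(* K is algebraically closed in K(t). *)
Lemma hom_eval_eq0 (K : fieldType) d (h a b : {poly K}) : h != 0 -> (size h <= d.+1)%N ->
  b != 0 -> hom_eval d (map_poly polyC h) a b = 0 -> exists c, a = c *: b.
Proof.
move=> h_n0 le_hd b_n0.
pose g := gcdp a b; pose a' := a %/ g; pose b' := b %/ g.
have defa : a = a' * g by rewrite divpK // dvdp_gcdl.
have defb : b = b' * g by rewrite divpK // dvdp_gcdr.
have g_n0 : g != 0 by apply: contraNneq b_n0 => g0; rewrite defb g0 mulr0.
have b'_n0 : b' != 0 by apply: contraNneq b_n0 => b0; rewrite defb b0 mul0r.
rewrite {1}defa {1}defb hom_eval_scale => /eqP.
rewrite mulf_eq0 expf_eq0 (negPf g_n0) andbF orbF => /eqP hab0.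
have cop : coprimep b' a' by rewrite coprimep_sym coprimep_div_gcd // b_n0 orbT.
pose k := (size h).-1.
have sz_h : size h = k.+1 by rewrite prednK // size_poly_gt0.
(* Lowering [d] to the exact degree k of [h] makes h_k a'^k the only term without a factor b'; as b'
   is coprime to a', it is a constant. *)
have {}hab0 : hom_eval k (map_poly polyC h) a' b' = 0.
  have le_kd : (k <= d)%N by rewrite -ltnS -sz_h.
  move: hab0; rewrite -(subnKC le_kd) hom_eval_widen; last by rewrite size_map_polyC sz_h.
  by move/eqP; rewrite mulf_eq0 expf_eq0 (negPf b'_n0) andbF orbF => /eqP.
have /size_poly1P[c c_n0 defb'] : size b' == 1%N.
  rewrite -dvdp1 -(Gauss_dvdpr _ (coprimep_expr k cop)) mulr1.
  move: hab0; rewrite /hom_eval big_ord_recr /= subnn mulr1 coef_map /= => /eqP.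
  rewrite addrC addr_eq0 => /eqP eq_lead.
  have lch_n0 : h`_k != 0 by rewrite -lead_coefE lead_coef_eq0.
  rewrite -(dvdpZr _ _ lch_n0) -mul_polyC eq_lead dvdpNr.
  elim/big_ind: _ => [|u v|j _]; [exact: dvdp0 | exact: dvdp_add |].
  by rewrite dvdp_mull // -(subnSK (ltn_ord j)) exprS dvdp_mulIl.
have sz_a' : (size a' <= 1)%N.
  rewrite leqNgt; apply/negP => a'_gt1.
  pose q := \poly_(j < k.+1) (h`_j * c ^+ (k - j)).
  have : q \Po a' == 0.
    rewrite -hab0 /q poly_def rmorph_sum; apply/eqP; apply: eq_bigr => j _.
    rewrite /= comp_polyZ rmorphXn /= comp_polyX coef_map defb'.
    by rewrite -mul_polyC polyCM polyC_exp mulrAC.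
  rewrite comp_poly_eq0 // => /eqP q0.
  have := congr1 (fun q : {poly K} => q`_k) q0.
  rewrite /= coef_poly ltnSn subnn mulr1 coef0 -lead_coefE => /eqP.
  by rewrite lead_coef_eq0 (negPf h_n0).
exists (a'`_0 / c).
rewrite defa defb defb' (size1_polyC sz_a') -!mul_polyC mulrA -polyCM coefC eqxx.
by rewrite mulfVK.
Qed.

(* Here phi stands for the inclusion in E of K[h(x)]. *)
Lemma integral_over_value (K : fieldType) (E : comNzRingType)
    (iota : {rmorphism K -> E}) (phi : {rmorphism {poly K} -> E})
    (h q : {poly K}) (x : E) :
    phi \o polyC =1 iota -> (1 < size h)%N -> (map_poly iota h).[x] = phi 'X ->
  integralOver phi (map_poly iota q).[x].
Proof.
move=> phiC h_gt1 hx.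
have lc_n0 : lead_coef h != 0 by rewrite lead_coef_eq0 -size_poly_gt0 ltnW.
have map_phi u : map_poly phi u^:P = map_poly iota u.
  by rewrite -map_poly_comp; apply: eq_map_poly.
apply: integral_horner => [|].
  apply/integral_poly => i; rewrite coef_map.
  by rewrite -[X in integralOver _ X]phiC; apply: integral_id.
(* [x] is a root of h(X) - h(x), made monic; here ['X%:P] stands for the coefficient h(x). *)
exists ((lead_coef h)^-1%:P *: (h^:P - 'X%:P)).
  rewrite monicE lead_coefZ lead_coefDl.
    by rewrite lead_coef_map_inj -?polyCM ?mulVf //; apply: polyC_inj.
  rewrite size_map_polyC // size_polyN.
  by apply: leq_ltn_trans h_gt1; rewrite size_polyC leq_b1.
rewrite /root -mul_polyC rmorphM /= rmorphB /= map_phi !map_polyC hornerM.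
by rewrite hornerD hornerN hx !hornerC subrr mulr0.
Qed.

(** * Subalgebras of K[x] and their fraction fields *)

Section Subalgebra.
Variables (K : fieldType) (n : nat) (R : set {mpoly K[n]}).
Hypothesis hR : is_subalgebra R.
Implicit Types a b g r s p : {mpoly K[n]}.
Local Notation frac := (@tofrac {mpoly K[n]}).

Lemma subalgebraP : [/\ R 1, forall a b, R a -> R b -> R (a + b),
  forall c a, R a -> R (c *: a) & forall a b, R a -> R b -> R (a * b)].
Proof.
case: hR => /= R1 Rlin Rmul; rewrite !inE in R1.
have lin c a b : R a -> R b -> R (c *: a + b).
  by move=> Ra Rb; have := Rlin c a b; rewrite !inE; apply.
have R0 : R 0 by rewrite -(addNr 1) -scaleN1r; apply: lin.
split=> // [a b Ra Rb|c a Ra|a b Ra Rb].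
- by rewrite -[a]scale1r; apply: lin.
- by rewrite -[_ *: _]addr0; apply: lin.
- by have := Rmul a b; rewrite !inE; apply.
Qed.

Lemma subalgebraC c : R c%:MP.
Proof.
have [R1 _ RZ _] := subalgebraP.
by rewrite -[_%:MP]mulr1 mul_mpolyC; apply: RZ.
Qed.

Lemma subalgebra_exp a k : R a -> R (a ^+ k).
Proof.
have [R1 _ _ RM] := subalgebraP => Ra.
by elim: k => [|k IHk]; rewrite ?expr0 // exprS; apply: RM.
Qed.

Lemma subalgebra_hom_eval d (q : {poly {mpoly K[n]}}) r s :
  (forall i, R q`_i) -> R r -> R s -> R (hom_eval d q r s).
Proof.
have [R1 RD _ RM] := subalgebraP => Rq Rr Rs.
rewrite /hom_eval; elim/big_ind: _ => // [|j _].
  by rewrite -mpolyC0; apply: subalgebraC.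
by apply: (RM); [apply: (RM) => // | ]; apply: subalgebra_exp.
Qed.

Lemma subalgebra_horner_alg g (q : {poly K}) : R g -> R (horner_alg g q).
Proof.
have [R1 RD RZ RM] := subalgebraP => Rg.
elim/poly_ind: q => [|q c IHq].
  by rewrite rmorph0 -mpolyC0; apply: subalgebraC.
rewrite rmorphD rmorphM /= horner_algX horner_algC.
by apply: (RD); [apply: (RM) | apply: (RZ)].
Qed.

Lemma frac_fieldE a : R a -> frac_field R (frac a).
Proof.
have [R1 _ _ _] := subalgebraP => Ra.
by exists a, 1; split; rewrite ?oner_eq0 // tofrac1 divr1.
Qed.

Lemma frac_field_subfield : is_subfield (frac_field R).
Proof.
have [R1 RD RZ RM] := subalgebraP.
split=> /= [|x y|x y]; rewrite !inE.
- by rewrite -tofrac1; apply: frac_fieldE.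
- move=> [a [b [Ra Rb b_n0 ->]]] [a' [b' [Ra' Rb' b'_n0 ->]]].
  exists (a * b' - a' * b), (b * b'); split; rewrite ?mulf_neq0 //.
  + by apply: (RD); [|rewrite -scaleN1r; apply: (RZ)]; apply: (RM).
  + exact: RM.
  + by rewrite tofracB !tofracM -mulNr addf_div ?tofrac_eq0 // mulNr.
- move=> [a [b [Ra Rb b_n0 ->]]] [a' [b' [Ra' Rb' b'_n0 ->]]].
  have [-> | a'_n0] := eqVneq a' 0.
    exists 0, 1; split; rewrite ?oner_eq0 //.
      by rewrite -mpolyC0; apply: subalgebraC.
    by rewrite tofrac0 !mul0r invr0 mulr0.
  exists (a * b'), (b * a'); split; rewrite ?mulf_neq0 //; try exact: RM.
  by rewrite !tofracM invf_div mulf_div.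
Qed.

Lemma tofrac_hom_eval d (q : {poly {mpoly K[n]}}) a b : (size q <= d.+1)%N ->
  b != 0 -> frac (hom_eval d q a b) = frac b ^+ d * (map_poly frac q).[frac a / frac b].
Proof.
move=> le_qd b_n0; rewrite rmorph_hom_eval -hom_eval_mul.
  by rewrite mulrC divfK // tofrac_eq0.
exact: leq_trans (size_poly _ _) le_qd.
Qed.

Lemma kronecker_horner_alg N g (q : {poly K}) :
  kronecker K n N (horner_alg g q) = q \Po kronecker K n N g.
Proof.
rewrite /horner_alg /horner_morph -horner_map /= -map_poly_comp /comp_poly.
congr (_.[_]); apply: eq_map_poly => c /=.
by rewrite -mul_mpolyC mulr1 mmapC.
Qed.

(** If a nonzero [g] were killed, the constant coefficient of its relation over K(a/b) would be
    killed too. This makes the quotient of the images of [a] and [b] algebraic over K, hence a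
    constant, against their linear independence. *)
Lemma kronecker_inj_of_algebraic N a b g : b != 0 ->
    (forall c d, kronecker K n N (c *: a + d *: b) = 0 -> c *: a + d *: b = 0) ->
    (forall c, a != c *: b) ->
    algebraic_over (adjoin (ratC K n) [set frac a / frac b]) (frac g) ->
  kronecker K n N g = 0 -> g = 0.
Proof.
move=> b_n0 indep nab [q [q_n0 Eq qg0]] phi_g0; apply: contrapT => /eqP g_n0.
(* As [g] is nonzero, factors X can be divided out of the relation. *)
wlog q0_n0 : q q_n0 Eq qg0 / q`_0 != 0.
  move=> wl; elim/poly_ind: q q_n0 Eq qg0 => [|q c IHq]; first by rewrite eqxx.
  have [-> | c_n0] := eqVneq c 0; last first.
    move=> q_n0 Eq qg0; apply: (wl _ q_n0 Eq qg0).
    by rewrite coefD coefMX coefC add0r.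
  rewrite addr0 mulf_eq0 negb_or => /andP[q_n0 _] Eq.
  rewrite rootM rootX tofrac_eq0 (negPf g_n0) orbF.
  by apply: IHq => // i; have := Eq i.+1; rewrite coefMX.
have [v [W [v_n0 defW]]] := clear_denominators Eq.
set tau := frac a / frac b in Eq v_n0 defW.
(* [D] bounds all coefficients of [W] at once, so the same power b^D clears every denominator. *)
pose D := sizeY W.
pose H (u : {poly K}) := hom_eval D (map_poly (@mpolyC n K) u) a b.
have fracH (u : {poly K}) : (size u <= D.+1)%N ->
    frac (H u) = frac b ^+ D * ev (ratC K n) tau u.
  move=> le_uD; rewrite /H tofrac_hom_eval //; last exact: leq_trans (size_poly _ _) _.
  by rewrite -map_poly_comp.
have le_W i : (size (W`_i)%R <= D.+1)%N by rewrite ltnW // ltnS max_size_coefXY.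
pose G := \poly_(i < size W) H W`_i.
have coefG i : G`_i = H W`_i.
  rewrite coef_poly; case: ltnP => // le_Wi; rewrite nth_default //.
  by rewrite /H rmorph0 /hom_eval big1 // => j _; rewrite coef0 !mul0r.
have mapG : map_poly frac G = frac b ^+ D *: map_poly (ev (ratC K n) tau) W.
  by apply/polyP => i; rewrite coefZ !coef_map coefG; apply: fracH.
have Gg0 : G.[g] = 0.
  apply/eqP; rewrite -tofrac_eq0 -horner_map /= mapG -defW !hornerZ.
  by rewrite (rootP qg0) (mulr0 (ev _ _ v)) mulr0 eqxx.
have : kronecker K n N G`_0 = 0.
  have := congr1 (kronecker K n N) Gg0.
  by rewrite -horner_map /= phi_g0 rmorph0 horner_coef0 coef_map.
rewrite coefG /H rmorph_hom_eval -map_poly_comp.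
rewrite (@eq_map_poly _ _ _ polyC) => [|c]; last by rewrite /= mmapC.
have W0_n0 : W`_0 != 0.
  have := congr1 (fun p : {poly {fraction {mpoly K[n]}}} => p`_0) defW.
  rewrite /= coefZ coef_map => eq0; apply: contraTneq isT => W00.
  by have := mulf_neq0 v_n0 q0_n0; rewrite eq0 W00 raddf0 eqxx.
have phib_n0 : kronecker K n N b != 0.
  apply: contra_neq b_n0 => phib0.
  by have := indep 0 1; rewrite scale0r scale1r add0r; apply.
case/(hom_eval_eq0 W0_n0 (le_W 0%N) phib_n0) => c eq_phi.
have /eqP := nab c; apply; apply/eqP; rewrite -subr_eq0 -scaleNr -[a]scale1r.
apply/eqP/indep; rewrite scale1r scaleNr rmorphB /= -[c *: b]mul_mpolyC rmorphM /=.
by rewrite mmapC mul_polyC; apply/eqP; rewrite subr_eq0; apply/eqP.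
Qed.
End Subalgebra.

(** * Subalgebras of transcendence degree one *)

Section TranscendenceDegreeOne.
Variables (K : fieldType) (n : nat) (R : set {mpoly K[n]}).
Hypothesis hR : is_subalgebra R.
Hypothesis htr : has_trdeg (ratC K n) (frac_field R) 1.
Implicit Types a b g r s p w : {mpoly K[n]}.
Local Notation frac := (@tofrac {mpoly K[n]}).

(** For a transcendence basis a/b, the numerator is not a scalar multiple of the denominator, and
    all of [R] is algebraic over K(a/b). A substitution keeping [a] and [b] independent is thus
    injective on [R], and cannot send both to constants. *)
Lemma exists_faithful_kronecker : exists N,
  (forall g, R g -> kronecker K n N g = 0 -> g = 0) /\
  (exists2 f, R f & (1 < size (kronecker K n N f))%N).
Proof.
case: htr => t [/(_ ord0)[a [b [Ra Rb b_n0 deft]]] tindep talg].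
have [N indep] := kronecker_lin_indep a b.
have nab c : a != c *: b.
  apply/eqP => defa.
  have deftc : t ord0 = ratC K n c.
    rewrite deft defa -mul_mpolyC tofracM mulfK ?tofrac_eq0 //.
  have /tindep/eqP : mmap (ratC K n) t ('X_ord0 - c%:MP) = 0.
    by rewrite mmapB mmapX mmap1U mmapC deftc subrr.
  apply/negP; apply/eqP => /(congr1 (fun p : {mpoly K[1]} => p@_U_(ord0))).
  rewrite mcoeffB mcoeffX mcoeffC mcoeff0 eqxx mnm1_eq0 mulr0 subr0.
  by move/eqP; rewrite oner_eq0.
have range_t : range t = [set frac a / frac b].
  apply/seteqP; split=> [_ [i _ <-]|_ ->]; first by rewrite ord1.
  by exists ord0.
exists N; split=> [g Rg|].
  apply: (kronecker_inj_of_algebraic b_n0 indep nab).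
  by rewrite -range_t; apply: talg; apply: frac_fieldE.
have [a_gt1 | a_le1] := ltnP 1 (size (kronecker K n N a)); first by exists a.
have [b_gt1 | b_le1] := ltnP 1 (size (kronecker K n N b)); first by exists b.
exfalso; have phiZ c g : kronecker K n N (c *: g) = c *: kronecker K n N g.
  by rewrite -mul_mpolyC rmorphM /= mmapC mul_polyC.
have phi_inj c d : c *: kronecker K n N a + d *: kronecker K n N b = 0 ->
    c *: a + d *: b = 0.
  by move=> e; apply: indep; rewrite rmorphD /= !phiZ.
pose x := (kronecker K n N a)`_0; pose y := (kronecker K n N b)`_0.
have y_n0 : y != 0.
  apply: contra_neq b_n0 => y0; have := phi_inj 0 1.
  rewrite (size1_polyC b_le1) -/y y0 polyC0 !scale0r scaler0 addr0 add0r scale1r.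
  exact.
have := phi_inj 1 (- (x / y)).
rewrite (size1_polyC a_le1) (size1_polyC b_le1) -/x -/y scale1r scaleNr.
rewrite -mul_polyC -polyCM divfK // subrr => /(_ erefl) /eqP.
by rewrite scale1r scaleNr subr_eq0; apply/negP/nab.
Qed.

Lemma rat_in_subset p : frac_field R (frac p) -> rat_in p `<=` frac_field R.
Proof.
move=> Lp z; apply; first exact: frac_field_subfield.
  by move=> _ [c _ <-]; exact/(frac_fieldE hR)/(subalgebraC hR).
by move=> _ ->; exact: Lp.
Qed.

Lemma frac_field_generated_by_poly : exists p, frac_field R = rat_in p.
Proof.
have [R1 RD RZ RM] := subalgebraP hR.
have [N [inj [f Rf f_gt1]]] := exists_faithful_kronecker.
set phi := kronecker K n N in inj f_gt1.
pose S (u : {poly K}) := exists2 g, R g & u = phi g.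
have SC c : S c%:P by exists c%:MP; [apply: (subalgebraC hR) | rewrite /phi /= mmapC].
have SD u v : S u -> S v -> S (u + v).
  by move=> [g Rg ->] [h Rh ->]; exists (g + h); [apply: RD | rewrite rmorphD].
have SM u v : S u -> S v -> S (u * v).
  by move=> [g Rg ->] [h Rh ->]; exists (g * h); [apply: RM | rewrite rmorphM].
have Sf : S (phi f) by exists f.
have [B [c [[s Rs defB] [r Rr defBc] B_n0 Sc]]] := luroth_univariate SC SD SM Sf f_gt1.
have s_n0 : s != 0 by apply: contra_neq B_n0 => s0; rewrite defB s0 rmorph0.
(* t is a root of phi(f)(X) - phi(f)(t), hence integral over K[phi(f)], and so is its polynomial
   [c]. *)
have [q mon_q qc0] : integralOver (comp_poly (phi f)) c.
  rewrite -[c]comp_polyXr /comp_poly.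
  apply: (@integral_over_value _ _ polyC (comp_poly (phi f)) (phi f)) => //.
    by move=> k /=; rewrite comp_polyC.
  by rewrite -/(comp_poly 'X (phi f)) comp_polyXr; symmetry; apply: comp_polyX.
pose Q := map_poly (horner_alg f) q.
have mon_Q : Q \is monic by apply: monic_map.
have RQ i : R Q`_i by rewrite coef_map; apply: subalgebra_horner_alg.
(* The cleared relation for r / s over K[f] lies in [R], so it can be checked after [phi]. *)
have Q0 : hom_eval (size Q).-1 Q r s = 0.
  apply: inj; first exact: subalgebra_hom_eval.
  rewrite rmorph_hom_eval -map_poly_comp -defBc -defB.
  rewrite (@eq_map_poly _ _ _ (comp_poly (phi f))); last first.
    by move=> u; apply: kronecker_horner_alg.
  rewrite hom_eval_mul ?(rootP qc0) ?mulr0 //.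
  rewrite prednK ?size_poly_gt0 ?monic_neq0 //.
  by rewrite !size_map_poly_id0 // (monicP mon_q) rmorph1 oner_neq0.
have [p defr] := mpoly_integrally_closed s_n0 mon_Q Q0.
have phi_p : phi p = c.
  by apply: (mulfI B_n0); rewrite defBc defr rmorphM mulrC -defB.
have lift g : R g -> exists h, g = horner_alg p h.
  move=> Rg; have [|h defg] := Sc (phi g); first by exists g.
  exists h; apply/eqP; rewrite -subr_eq0.
  (* [p] need not lie in [R], where [phi] is injective; multiplying by a power of [s] turns h(p)
     into a form in [r] and [s], which does. *)
  have : s ^+ size h * (g - horner_alg p h) == 0.
    apply/eqP/inj; last first.
      by rewrite rmorphM rmorphB /= kronecker_horner_alg -/phi phi_p defg subrr mulr0.
    have Rs_h := subalgebra_exp hR (size h) Rs.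
    rewrite mulrBr -scaleN1r; apply: (RD); first exact: RM.
    apply: (RZ); rewrite /horner_alg /horner_morph -hom_eval_mul; last first.
      by rewrite (leq_trans (size_poly _ _)).
    rewrite [s * p]mulrC -defr; apply: subalgebra_hom_eval => // i.
    by rewrite coef_map; apply: (RZ).
  by rewrite mulf_eq0 expf_eq0 (negPf s_n0) andbF.
exists p; apply/seteqP; split; last first.
  apply: rat_in_subset; exists r, s; split=> //.
  by rewrite defr tofracM mulfK // tofrac_eq0.
move=> _ [a [b [Ra Rb b_n0 ->]]].
have [u defa] := lift a Ra; have [v defb] := lift b Rb.
by apply/adjoin1P; exists u, v; rewrite !ev_tofrac -defa -defb tofrac_eq0.
Qed.

Lemma poly_in_of_rat_in p w : rat_in p (frac w) -> poly_in p w.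
Proof.
move=> /adjoin1P[u [v]]; rewrite !ev_tofrac tofrac_eq0 => -[v_n0 defw].
apply: (poly_in_of_quotient v_n0).
apply/eqP; rewrite -tofrac_eq tofracM defw mulrC divfK // tofrac_eq0 //.
Qed.

Lemma rat_in_of_poly_in p w : poly_in p w -> rat_in p (frac w).
Proof.
move=> [u _ <-]; apply/adjoin1P; exists u, 1.
by rewrite !ev_tofrac rmorph1 tofrac1 divr1 oner_eq0.
Qed.

Lemma poly_of_integral z : frac_field R z -> integral_over (frac @` R) z ->
  exists w, z = frac w.
Proof.
move=> [a [b [Ra Rb b_n0 ->]]] [q [mon_q Rq qz0]].
have /choice[g defg] : forall i, exists g, frac g = q`_i.
  by move=> i; have [g _ defg] := Rq i; exists g.
pose Q := \poly_(i < size q) g i.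
have mapQ : map_poly frac Q = q.
  apply/polyP => i; rewrite coef_map coef_poly.
  by case: ltnP => [_|le_qi]; [apply: defg | rewrite raddf0 nth_default].
have sz_Q : size Q = size q.
  by rewrite -mapQ size_map_inj_poly ?rmorph0 // => x y /eqP; rewrite tofrac_eq => /eqP.
have mon_Q : Q \is monic.
  rewrite monicE -tofrac_eq tofrac1 lead_coefE -coef_map mapQ sz_Q.
  by rewrite -lead_coefE (monicP mon_q) eqxx.
have le_Q : (size Q <= (size Q).-1.+1)%N by rewrite prednK // size_poly_gt0 monic_neq0.
have [|w ->] := @mpoly_integrally_closed K n Q a b b_n0 mon_Q _.
  apply/eqP; rewrite -tofrac_eq0 (tofrac_hom_eval _ le_Q b_n0).
  by rewrite mapQ (rootP qz0) mulr0 eqxx.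
by exists w; rewrite tofracM mulfK // tofrac_eq0.
Qed.

(** A nonconstant f = h(p) in [R] makes [p] a root of h(X) - f, hence integral over K[f];
    polynomials in [p] follow. *)
Lemma integral_of_poly_in p w : frac_field R = rat_in p -> poly_in p w ->
  integral_over (frac @` R) (frac w).
Proof.
move=> defL [q _ <-].
have [N [_ [f Rf f_gt1]]] := exists_faithful_kronecker.
have [h _ defh] : poly_in p f.
  by apply: poly_in_of_rat_in; rewrite -defL; apply: frac_fieldE.
have h_gt1 : (1 < size h)%N.
  rewrite ltnNge; apply/negP => /size1_polyC hC; move: f_gt1; rewrite -defh hC.
  by rewrite kronecker_horner_alg comp_polyC ltnNge size_polyC leq_b1.
pose psi : {rmorphism {poly K} -> {fraction {mpoly K[n]}}} := (frac \o horner_alg f)%FUN.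
have ev_p u : frac (horner_alg p u) = (map_poly (ratC K n) u).[frac p].
  by rewrite -ev_tofrac.
have [||P mon_P Pw0] :=
  @integral_over_value _ _ (ratC K n) psi h q (frac p) _ h_gt1.
- by move=> c; rewrite /= horner_algC -mul_mpolyC mulr1.
- by rewrite -ev_p defh /= horner_algX.
exists (map_poly psi P); split; first exact: monic_map.
  move=> i; rewrite coef_map; exists (horner_alg f P`_i) => //.
  exact: subalgebra_horner_alg.
by rewrite ev_p.
Qed.
End TranscendenceDegreeOne.

Theorem corollary3p2 (K : fieldType) (n : nat) (R : set {mpoly K[n]})
    (L : set {fraction {mpoly K[n]}})
    (hR : is_subalgebra R) (hL : L = frac_field R)
    (htr : has_trdeg (ratC K n) L 1) :
  (exists p : {mpoly K[n]}, L = rat_in p) /\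
  (forall p : {mpoly K[n]}, L = rat_in p ->
     [/\ R `<=` poly_in p,
         (@tofrac {mpoly K[n]}) @` poly_in p
           = rat_in p `&` range (@tofrac {mpoly K[n]})
       & (@tofrac {mpoly K[n]}) @` poly_in p
           = integral_closure ((@tofrac {mpoly K[n]}) @` R) L]).
Proof.
subst L; split; first exact: frac_field_generated_by_poly.
move=> p defL; split.
- by move=> a Ra; apply: poly_in_of_rat_in; rewrite -defL; apply: frac_fieldE.
- apply/seteqP; split=> [_ [w pw <-]|z [pz [w _ defz]]].
    by split; [apply: rat_in_of_poly_in | exists w].
  by exists w => //; apply: poly_in_of_rat_in; rewrite defz.
- apply/seteqP; split=> [_ [w pw <-]|z [Lz]].
    split; last exact: (integral_of_poly_in hR htr defL pw).
    by rewrite [X in X _]defL; apply: rat_in_of_poly_in.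
  move=> /(poly_of_integral Lz)[w defz]; exists w => //.
  by apply: poly_in_of_rat_in; rewrite -defL -defz.
Qed.
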